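(* Let $(\mathcal{X},\Sigma,\{P_\theta\}_{\theta\in\Theta})$ be a statistical model and $\mu:\Sigma\to\overline{\mathbb{R}}$ a $\sigma$-finite measure such that $P_\theta\ll\mu$ for every $\theta\in\Theta$. Suppose that $(\mathcal{X},\Sigma)$ is an analytic Borel space. For each $\theta\in\Theta$, let $f_\theta:\mathcal{X}\to\mathbb{R}$ be a density of $P_\theta$ with respect to $\mu$. Suppose that there exist functions $\eta_1,\dots,\eta_k,B:\Theta\to\mathbb{R}$ and measurable functions $T_1,\dots,T_k,h:\mathcal{X}\to\mathbb{R}$ such that, for each $\theta\in\Theta$, $$f_\theta(x)=\exp\Big[\Big(\sum_{i=1}^k\eta_i(\theta)T_i(x)\Big)-B(\theta)\Big]h(x)\quad\mu\text{-a.e.}$$ If for any $a_0,\dots,a_k\in\mathbb{R}$ satisfying $\sum_{i=1}^k a_i\eta_i(\theta)=a_0$ for every $\theta\in\Theta$ we have $a_i=0$ for every $i\in\{0,\dots,k\}$, then $T:\mathcal{X}\to\mathbb{R}^k$ given by $T(x):=(T_1(x),\dots,T_k(x))$ is a minimal sufficient statistic.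
   Context: A statistical model is a triple $(\mathcal{X},\Sigma,\{P_\theta\}_{\theta\in\Theta})$ with $(\mathcal{X},\Sigma)$ a measurable space, $\Theta$ a non-empty set and each $P_\theta$ a probability measure on $(\mathcal{X},\Sigma)$. A statistic is a measurable function $T:\mathcal{X}\to\mathcal{T}$ into a measurable space $(\mathcal{T},\Sigma_{\mathcal{T}})$. $T$ is sufficient iff for each $E\in\Sigma$ there is a measurable $\kappa_E:\mathcal{T}\to\mathbb{R}$ such that for every $\theta\in\Theta$, $P_\theta(E\mid T)=\kappa_E(T)$ $P_\theta$-a.e. (where $P_\theta(E\mid T)$ is the conditional probability given $\sigma(T)$). $T$ is minimal sufficient iff it is sufficient and, for every measurable space $(\mathcal{S},\Sigma_{\mathcal{S}})$ and every sufficient statistic $S:\mathcal{X}\to\mathcal{S}$, there is a measurable $f:\mathcal{S}\to\mathcal{T}$ such that for each $\theta\in\Theta$, $T=f(S)$ $P_\theta$-a.e. A density of $P_\theta$ with respect to $\mu$ is a Radon--Nikodym derivative $dP_\theta/d\mu$. $\mathbb{R}$ and $\mathbb{R}^k$ carry their Borel $\sigma$-algebras. A measurable space is separable iff its $\sigma$-algebra is generated by a countable collection of measurable sets and every singleton is measurable. A standard Borel space is a measurable space whose $\sigma$-algebra is the Borel $\sigma$-algebra of a complete separable metric space. A measurable space $(\mathcal{X},\Sigma)$ is analytic Borel iff it is separable and there exist a standard Borel space $(\mathcal{Y},\Sigma_{\mathcal{Y}})$ and a surjective measurable function $\mathcal{Y}\to\mathcal{X}$. *)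

(* Defs.v *)
From HB Require Import structures.
From mathcomp Require Import all_boot all_order all_algebra.
From mathcomp Require Import all_classical all_reals all_analysis.
Set Implicit Arguments.
Unset Strict Implicit.
Unset Printing Implicit Defensive.
Import Order.TTheory GRing.Theory Num.Theory.
Import numFieldNormedType.Exports.
Local Open Scope classical_set_scope.
Local Open Scope ring_scope.

(* Types carrying a measurableType structure are pointed, hence nonempty; this
   excludes nothing below, since a space that carries a probability measure,
   or receives a map from one that does, is nonempty. *)

Definition complete_separable (R : realType) (M : metricType R) : Prop :=
  (forall F : set_system M, ProperFilter F -> cauchy F ->
     exists x : M, F --> x) /\
  (exists2 D : set M, countable D & dense D).

(* [m] ranges over the metric structures on the carrier of Y; the sets of [m]
   that matter are its open sets, and [<<s _ >>] is the generated
   sigma-algebra on the full set. *)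
Definition standard_Borel (R : realType) (d : measure_display)
    (Y : measurableType d) : Prop :=
  exists m : Metric.axioms_ R Y,
    let M : metricType R := Metric.Pack m in
    complete_separable M /\
    @measurable d Y = <<s (@open M : set (set Y)) >>.

Definition separable_measurable (d : measure_display) (X : measurableType d)
    : Prop :=
  (exists2 C : set (set X), countable C & @measurable d X = <<s C >>) /\
  (forall x : X, measurable [set x]).

Definition analytic_Borel (R : realType) (d : measure_display)
    (X : measurableType d) : Prop :=
  separable_measurable X /\
  exists (d' : measure_display) (Y : measurableType d'),
    standard_Borel R Y /\
    exists2 phi : Y -> X, measurable_fun [set: Y] phi &
      forall x : X, exists y : Y, phi y = x.

(* [f] is a (real-valued) version of dP/dmu. *)
Definition is_density (R : realType) (d : measure_display)
    (X : measurableType d) (mu : {measure set X -> \bar R})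
    (P : probability X R) (f : X -> R) : Prop :=
  mu.-integrable [set: X] (EFin \o f) /\
  forall A : set X, measurable A -> P A = (\int[mu]_(x in A) (f x)%:E)%E.

(* [g] is a version of P(E | T): measurable for the sigma-algebra sigma(T)
   generated by T, which is the one carried by
   [g_sigma_algebra_preimageType T], and with integral P(E n A) over each A
   in sigma(T). *)
Definition is_cond_prob (R : realType) (d d' : measure_display)
    (X : measurableType d) (TT : measurableType d')
    (P : probability X R) (E : set X) (T : X -> TT) (g : X -> R) : Prop :=
  [/\ measurable_fun [set: g_sigma_algebra_preimageType T]
        (g : g_sigma_algebra_preimageType T -> R),
      P.-integrable [set: X] (EFin \o g) &
      forall A : set X, g_sigma_algebra_preimage T A ->
        (\int[P]_(x in A) (g x)%:E)%E = P (E `&` A)].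

Definition sufficient (R : realType) (d d' : measure_display)
    (X : measurableType d) (TT : measurableType d') (Theta : Type)
    (P : Theta -> probability X R) (T : X -> TT) : Prop :=
  measurable_fun [set: X] T /\
  forall E : set X, measurable E ->
    exists2 kappa : TT -> R, measurable_fun [set: TT] kappa &
      forall theta : Theta,
        exists2 g : X -> R, is_cond_prob (P theta) E T g &
          {ae P theta, forall x, g x = kappa (T x)}.

Definition minimal_sufficient (R : realType) (d d' : measure_display)
    (X : measurableType d) (TT : measurableType d') (Theta : Type)
    (P : Theta -> probability X R) (T : X -> TT) : Prop :=
  sufficient P T /\
  forall (d'' : measure_display) (SS : measurableType d'') (S : X -> SS),
    sufficient P S ->
    exists2 f : SS -> TT, measurable_fun [set: SS] f &
      forall theta : Theta, {ae P theta, forall x, T x = f (S x)}.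

(* R^k with the Borel sigma-algebra of its usual topology. *)
Notation borel_rV R k := (g_sigma_algebraType (@open 'rV[R]_k)).

(* Main.v *)
Require Import Defs.
From HB Require Import structures.
From mathcomp Require Import all_boot all_order all_algebra.
From mathcomp Require Import all_classical all_reals all_analysis.
From mathcomp Require Import measurable_realfun ring.
Set Implicit Arguments.
Unset Strict Implicit.
Unset Printing Implicit Defensive.
Import Order.TTheory GRing.Theory Num.Theory.
Import numFieldNormedType.Exports.
Local Open Scope classical_set_scope.
Local Open Scope ring_scope.

(** Fix one parameter [theta0]. Since the exponential is positive, all the
    [P theta] have the same null sets, and on the support of [h] the density
    of [P theta] with respect to [P theta0] is
    [exp ((sum_i (eta_i theta - eta_i theta0) T_i) - (B theta - B theta0))]
    ([expfam_density]). Two facts about a family dominated by one of its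
    members, a form of the Halmos-Savage factorization theorem, then give the
    result.

    If these densities are functions of a statistic [T], then [T] is
    sufficient ([sufficient_of_factored_density]): a version of the
    conditional probability of [E] given [T] under [P theta0] serves for every
    [theta], because the density may be moved in and out of the conditional
    expectation. This applies to the exponential family.

    Conversely, if [S] is sufficient then each density is almost everywhere
    equal to some [rho theta (S x)] ([factored_density_of_sufficient]); the
    function [rho theta] is the Radon-Nikodym derivative of the law of [S]
    under [P theta] with respect to its law under [P theta0]. By uniqueness of
    densities and on taking logarithms, every linear combination
    [sum_i (eta_i theta - eta_i theta0) T_i] is, outside a null set, a
    measurable function of [S].
    The affine independence of the [eta_i] says that finitely many of the
    vectors [eta theta - eta theta0] span the whole space
    ([coordinates_from_differences]), so that each [T_i] is a linear
    combination of finitely many of these functions of [S]. *)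

(** * Densities *)

(** The change of variables known for the Radon-Nikodym derivative holds for
    every density, since densities are unique almost everywhere. *)
Lemma ge0_integral_density (R : realType) (d : measure_display)
    (X : measurableType d) (nu : {finite_measure set X -> \bar R})
    (mu : {sigma_finite_measure set X -> \bar R}) (w : X -> R) :
  measurable_fun [set: X] w -> (forall x, 0 <= w x) ->
  (forall A, measurable A -> nu A = (\int[mu]_(x in A) (w x)%:E)%E) ->
  forall (D : set X) (phi : X -> \bar R), measurable D ->
    measurable_fun D phi -> (forall x, (0 <= phi x)%E) ->
  (\int[nu]_(x in D) phi x = \int[mu]_(x in D) (phi x * (w x)%:E))%E.
Proof.
move=> mw w0 nuw D phi mD mphi phi0.
have numu : nu `<< mu.
  apply/null_content_dominatesP => A mA A0; rewrite nuw//.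
  by rewrite null_set_integral//; exact/measurable_EFinP/measurable_funTS.
have mRN := measurable_int _ (Radon_Nikodym_SigmaFinite.f_integrable numu).
have RNw : ae_eq mu D (Radon_Nikodym_SigmaFinite.f nu mu) (EFin \o w).
  apply: (@ae_eq_subset _ _ _ _ mu setT) => //; apply: integral_ae_eq => //.
  - exact: Radon_Nikodym_SigmaFinite.f_integrable.
  - exact/measurable_EFinP.
  - by move=> A _ mA; rewrite -Radon_Nikodym_SigmaFinite.f_integral// nuw.
rewrite -(Radon_Nikodym_SigmaFinite.change_of_variables numu)//.
apply: ge0_ae_eq_integral => //.
- by apply: emeasurable_funM => //; exact: measurable_funTS.
- by apply: emeasurable_funM => //; exact/measurable_EFinP/measurable_funTS.
- by move=> x _; rewrite mule_ge0// Radon_Nikodym_SigmaFinite.f_ge0.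
- by move=> x _; rewrite mule_ge0// lee_fin.
- exact: ae_eqe_mul2l.
Qed.

Lemma density_unique (R : realType) (d : measure_display)
    (X : measurableType d) (nu : {finite_measure set X -> \bar R})
    (mu : {measure set X -> \bar R}) (w1 w2 : X -> R) :
  measurable_fun [set: X] w1 -> measurable_fun [set: X] w2 ->
  (forall x, 0 <= w1 x) ->
  (forall A, measurable A -> nu A = (\int[mu]_(x in A) (w1 x)%:E)%E) ->
  (forall A, measurable A -> nu A = (\int[mu]_(x in A) (w2 x)%:E)%E) ->
  {ae mu, forall x, w1 x = w2 x}.
Proof.
move=> mw1 mw2 w10 nu1 nu2.
suff : ae_eq mu [set: X] (EFin \o w1) (EFin \o w2).
  by apply: filterS => x /(_ Logic.I) [].
apply: integral_ae_eq => //.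
- apply/integrableP; split; first exact/measurable_EFinP.
  under eq_integral do rewrite /= ger0_norm//.
  by rewrite -nu1// ltey_eq fin_num_measure.
- exact/measurable_EFinP.
- by move=> A _ mA; rewrite -nu1// -nu2.
Qed.

(** On the set where the density is negative its integral is both nonpositive
    and a probability, hence zero. *)
Lemma density_ge0_ae (R : realType) (d : measure_display)
    (X : measurableType d) (mu : {measure set X -> \bar R})
    (P : probability X R) (f : X -> R) :
  is_density mu P f -> {ae mu, forall x, 0 <= f x}.
Proof.
move=> [fint fE].
have mf : measurable_fun [set: X] f.
  exact/measurable_EFinP/measurable_int/fint.
pose N : set X := [set x | f x < 0].
have mN : measurable N.
  by rewrite -[N]setTI; exact: measurable_fun_ltr.
have fN : (\int[mu]_(x in N) `|(f x)%:E| = 0)%E.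
  apply/eqP; rewrite eq_le integral_ge0// andbT.
  rewrite -leeN2 oppe0 -integral_ge0N//.
  rewrite (eq_integral (EFin \o f)); first by rewrite -fE.
  by move=> x; rewrite inE /N /= => fx; rewrite ltr0_norm// opprK.
have /ae_eq_integral_abs : measurable_fun N (EFin \o f).
  exact/measurable_EFinP/measurable_funTS.
move=> /(_ mu mN) [/(_ fN) + _]; apply: filterS => x /= fx.
by rewrite leNgt; apply/negP => fx0; have [f0] := fx fx0; rewrite f0 ltxx in fx0.
Qed.

(** * Sufficiency in a family dominated by one of its members *)

Lemma measurable_preimageT (d d' : measure_display) (X : measurableType d)
    (S : measurableType d') (T : X -> S) (B : set S) :
  measurable_fun [set: X] T -> measurable B -> measurable (T @^-1` B).
Proof. by move=> mT mB; rewrite -[X in measurable X]setTI; exact: mT. Qed.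

(** The function [kappa] is a version of the conditional probability of [E]
    given [T], as a function of the value of [T]: it is the Radon-Nikodym
    derivative of the image under [T] of the restriction of [P] to [E] with
    respect to the law of [T]. The weight [phi] is what makes one [kappa]
    usable for all the measures with density [phi \o T]. *)
Lemma ex_cond_prob_given (R : realType) (d d' : measure_display)
    (X : measurableType d) (S : measurableType d') (P : probability X R)
    (E : set X) (mE : measurable E) (T : {mfun X >-> S}) :
  exists kappa : S -> R, [/\ measurable_fun [set: S] kappa,
    forall s, 0 <= kappa s &
    forall (B : set S) (phi : S -> \bar R), measurable B ->
      measurable_fun [set: S] phi -> (forall s, (0 <= phi s)%E) ->
      (\int[distribution P T]_(s in B) (phi s * (kappa s)%:E) =
       \int[P]_(x in E `&` T @^-1` B) phi (T x))%E].
Proof.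
have Efin : (P E < +oo)%E by rewrite (le_lt_trans (probability_le1 _ _))// ltry.
pose PE : {finite_measure set X -> \bar R} := mfrestr mE Efin.
have mT : measurable_fun [set: X] T by exact: measurable_funP.
have mTB B : measurable B -> measurable (T @^-1` B).
  exact: measurable_preimageT.
pose nu1 : {measure set S -> \bar R} := pushforward PE T.
pose nu0 := nu1 mT.
have nufin : fin_num_fun nu0.
  by move=> B mB; apply: fin_num_measure; exact: mTB.
pose nuM := Measure_isFinite.Build _ _ _ nu0 nufin.
pose nu : {finite_measure set S -> \bar R} :=
  HB.pack (nu0 : set S -> \bar R) nu0 nuM.
have nuE B : nu B = P (E `&` T @^-1` B).
  by rewrite /= /pushforward /= /mfrestr /mrestr setIC.
have nudom : nu `<< distribution P T.
  apply/null_content_dominatesP => B mB PB0; rewrite nuE.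
  apply/eqP; rewrite -measure_le0 -PB0 le_measure// inE.
  - exact: measurableI (mTB _ mB).
  - exact: mTB.
have [w [w0 wfin wint nuw]] := radon_nikodym_sigma_finite nudom.
exists (fine \o w); split.
- apply: measurableT_comp => //; exact: measurable_int wint.
- by move=> s; exact: fine_ge0.
- move=> B phi mB mphi phi0.
  rewrite -(@ge0_integral_density _ _ _ nu)//; last 4 first.
  + by apply: measurableT_comp => //; exact: measurable_int wint.
  + by move=> s; exact: fine_ge0.
  + by move=> A mA; rewrite nuw//; apply: eq_integral => s _; rewrite /= fineK.
  + exact: measurable_funTS.
  rewrite (ge0_integral_pushforward mT PE mB); last 2 first.
  + exact: measurable_funTS.
  + by move=> s _; exact: phi0.
  have mphiT : measurable_fun [set: X] (phi \o T) by exact: measurableT_comp.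
  rewrite (@ge0_integral_density _ _ _ PE P (\1_E)) => //=.
  + rewrite setIC integral_mkcondr; apply: eq_integral => x _.
    by rewrite epatch_indic.
  + by move=> A mA; rewrite integral_indic//= /mfrestr /mrestr setIC.
  + exact: mTB.
  + exact: measurable_funTS.
Qed.

(** The factorization criterion. The conditional probability under [P0] is
    also one under each [P theta], since
    [int_(T in B) kappa(T) dP = int_(T in B) kappa(T) r(T) dP0
      = int_(E and T in B) r(T) dP0 = P (E and T in B)]. *)
Lemma sufficient_of_factored_density (R : realType) (d d' : measure_display)
    (X : measurableType d) (S : measurableType d') (Theta : Type)
    (P : Theta -> probability X R) (P0 : probability X R) (T : X -> S)
    (r : Theta -> S -> R) :
  measurable_fun [set: X] T ->
  (forall theta, measurable_fun [set: S] (r theta)) ->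
  (forall theta s, 0 <= r theta s) ->
  (forall theta A, measurable A ->
    P theta A = (\int[P0]_(x in A) (r theta (T x))%:E)%E) ->
  sufficient P T.
Proof.
move=> mT mr r0 Pr; split=> // E mE.
pose TT : {mfun X >-> S} := HB.pack T (isMeasurableFun.Build _ _ _ _ _ mT).
have [kappa [mk k0 kE]] := ex_cond_prob_given P0 mE TT.
exists kappa => // theta; exists (kappa \o T); last exact: aeW.
have mkT : measurable_fun [set: X] (kappa \o T) by exact: measurableT_comp.
have key B : measurable B ->
    (\int[P theta]_(x in T @^-1` B) (kappa (T x))%:E =
     P theta (E `&` T @^-1` B))%E.
  move=> mB; have mTB := measurable_preimageT mT mB.
  rewrite (@ge0_integral_density _ _ _ (P theta) P0 (r theta \o T))//=; last 4 first.
  - exact: measurableT_comp.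
  - exact: Pr.
  - exact/measurable_EFinP/measurable_funTS.
  - by move=> x; rewrite lee_fin.
  rewrite Pr; last exact: measurableI.
  rewrite -(kE B (EFin \o r theta))//; last 2 first.
  - exact/measurable_EFinP.
  - by move=> s; rewrite lee_fin.
  rewrite ge0_integral_pushforward//; last 2 first.
  - exact/measurable_EFinP/measurable_funTS/measurable_funM.
  - by move=> s _; rewrite mule_ge0 ?lee_fin.
  by apply: eq_integral => x _; rewrite /= muleC.
split.
- move=> _ A mA; exists (kappa @^-1` A) => //.
  by rewrite -[X in measurable X]setTI; exact: mk.
- apply/integrableP; split; first exact/measurable_EFinP.
  under eq_integral do rewrite /= ger0_norm//.
  rewrite -(preimage_setT T) key// (le_lt_trans (probability_le1 _ _))// ?ltry//.
  exact: measurableI (measurable_preimageT mT _).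
- by move=> _ [B mB <-]; rewrite setTI key.
Qed.

(** Transfers the defining property of a conditional probability to the law
    of the statistic. Here [kappa] may take negative values on a null set, so
    that its integrability has to be carried along. *)
Lemma cond_prob_law (R : realType) (d d' : measure_display)
    (X : measurableType d) (S : measurableType d') (P : probability X R)
    (E : set X) (T : {mfun X >-> S}) (kappa : S -> R) (g : X -> R) :
  measurable_fun [set: S] kappa -> is_cond_prob P E T g ->
  {ae P, forall x, g x = kappa (T x)} ->
  (distribution P T).-integrable [set: S] (EFin \o kappa) /\
  forall B, measurable B ->
    (\int[distribution P T]_(s in B) (kappa s)%:E = P (E `&` T @^-1` B))%E.
Proof.
move=> mk [_ gint gE] gk.
have mT : measurable_fun [set: X] T by exact: measurable_funP.
have mkT : measurable_fun [set: X] (EFin \o (kappa \o T)).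
  exact/measurable_EFinP/measurableT_comp.
have mg := measurable_int _ gint.
have gkT D : ae_eq P D (EFin \o g) (EFin \o (kappa \o T)).
  by apply: filterS gk => x /= -> .
have kTint : P.-integrable [set: X] (EFin \o (kappa \o T)).
  apply/integrableP; split=> //; case/integrableP: gint => _.
  rewrite (@ge0_ae_eq_integral _ _ _ _ _ _ (abse \o (EFin \o (kappa \o T))))//.
  - exact: measurableT_comp.
  - exact: measurableT_comp.
  - by move=> x _; exact: abse_ge0.
  - by apply: filterS gk => x /= -> .
split; first by apply: integrable_pushforward => //; exact/measurable_EFinP.
move=> B mB; have mTB := measurable_preimageT mT mB.
rewrite (@integral_pushforward _ _ _ _ _ T mT P B (EFin \o kappa))//; last 2 first.
- exact/measurable_EFinP.
- exact: integrableS kTint.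
rewrite -gE; last by exists B; rewrite ?setTI.
by apply: ae_eq_integral => //; [exact: measurable_funTS..|exact: ae_eq_sym].
Qed.

(** Let [rho] be the density of the law of [T] under [P theta] with respect
    to [law0], its law under [P theta0]. The conditional probability [kappa]
    of [E] given by sufficiency serves both [theta] and [theta0], hence
    [P theta E = int kappa rho dlaw0 = int_E rho(T) dP theta0]. *)
Lemma factored_density_of_sufficient (R : realType) (d d' : measure_display)
    (X : measurableType d) (S : measurableType d') (Theta : Type)
    (P : Theta -> probability X R) (T : X -> S) (theta0 theta : Theta) :
  sufficient P T -> P theta `<< P theta0 ->
  exists rho : S -> R, [/\ measurable_fun [set: S] rho,
    forall s, 0 <= rho s &
    forall A, measurable A ->
      P theta A = (\int[P theta0]_(x in A) (rho (T x))%:E)%E].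
Proof.
move=> [mT sufT] dom.
pose TT : {mfun X >-> S} := HB.pack T (isMeasurableFun.Build _ _ _ _ _ mT).
pose law t := distribution (P t) TT.
have lawdom : law theta `<< law theta0.
  apply/null_content_dominatesP => B mB B0.
  move/null_content_dominatesP: dom; apply => //.
  exact: measurable_preimageT.
have [w [w0 wfin wint lawE]] := radon_nikodym_sigma_finite lawdom.
have mw : measurable_fun [set: S] (fine \o w).
  by apply: measurableT_comp => //; exact: measurable_int wint.
have rho0 s : 0 <= (fine \o w) s by exact: fine_ge0.
exists (fine \o w); split=> // E mE.
have [kappa mk kP] := sufT E mE.
have [kappa0 [mk0 k00 k0E]] := ex_cond_prob_given (P theta0) mE TT.
have klaw t : (law t).-integrable [set: S] (EFin \o kappa) /\
    forall B, measurable B ->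
      (\int[law t]_(s in B) (kappa s)%:E = P t (E `&` T @^-1` B))%E.
  by have [g gP gk] := kP t; exact: (@cond_prob_law _ _ _ _ _ _ _ TT _ g).
(* [kappa] is determined by its integrals only up to sets of [law theta0]
   measure zero, and these are null for [law theta] as well. *)
have kk0 : ae_eq (law theta) [set: S] (EFin \o kappa) (EFin \o kappa0).
  apply: (null_dominates_ae_eq measurableT lawdom).
  apply: integral_ae_eq => //; first exact: (klaw theta0).1.
    exact/measurable_EFinP.
  move=> B _ mB; rewrite [LHS](klaw theta0).2//.
  transitivity (\int[law theta0]_(s in B) (cst 1%E s * (kappa0 s)%:E))%E; last first.
    by apply: eq_integral => s _; rewrite /= mul1e.
  rewrite (k0E B (cst 1%E))//.
  rewrite integral_cst ?mul1e//.
  exact: measurableI (measurable_preimageT mT mB).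
have := (klaw theta).2 _ measurableT.
rewrite preimage_setT setIT => <-.
rewrite (ae_eq_integral (EFin \o kappa0))//; last 2 first.
- exact/measurable_EFinP.
- exact/measurable_EFinP.
rewrite (@ge0_integral_density _ _ _ (law theta) (law theta0) (fine \o w))//=; last 2 first.
- by move=> B mB; rewrite lawE//; apply: eq_integral => s _; rewrite /= fineK.
- exact/measurable_EFinP.
have mwE : measurable_fun [set: S] (EFin \o (fine \o w)) by exact/measurable_EFinP.
have := k0E _ _ measurableT mwE (fun s => rho0 s).
rewrite preimage_setT setIT /= => <-.
by apply: eq_integral => s _; rewrite muleC.
Qed.

(** * Measurability of maps to and from row vectors *)

(** An open set of row vectors is the union of the balls with rational centre
    and radius [1/(n+1)] that it contains, a countable family. *)
Lemma measurable_row (R : realType) (d : measure_display)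
    (X : measurableType d) (k : nat) (F : X -> 'I_k -> R) :
  (forall i, measurable_fun [set: X] (fun x => F x i)) ->
  measurable_fun [set: X] ((fun x => \row_i F x i) : X -> borel_rV R k).
Proof.
move=> mF.
pose ctr (q : 'rV[rat]_k) : 'rV[R]_k := map_mx ratr q.
pose bal (c : 'rV[rat]_k * nat) := ball (ctr c.1) (c.2.+1%:R^-1 : R).
pose pre (c : 'rV[rat]_k * nat) : set X :=
  \big[setI/setT]_(i < k) [set x | `|ctr c.1 0 i - F x i| < c.2.+1%:R^-1].
have preE c x : pre c x <-> bal c (\row_i F x i).
  rewrite /pre -bigcap_seq /bal; split=> [cx|[_ cx] i _].
    split=> [|i j]; first by rewrite invr_gt0.
    by rewrite (ord1 i) [X in ball _ _ X]mxE; exact: (cx j (mem_index_enum j)).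
  by have := cx 0 i; rewrite [X in ball _ _ X]mxE.
have mpre c : measurable (pre c).
  apply: bigsetI_measurable => i _.
  rewrite [X in measurable X](_ : _ =
    (fun x => F x i) @^-1` ball (ctr c.1 0 i) (c.2.+1%:R^-1)) //.
  apply: measurable_preimageT => //; exact: measurable_ball.
apply: (@measurability _ _ X (borel_rV R k) _ _ (@open 'rV[R]_k)) => // _ [U oU <-].
rewrite setTI.
rewrite [X in measurable X](_ : _ =
   \bigcup_(c : 'rV[rat]_k * nat) (if `[< bal c `<=` U >] then pre c else set0)).
  apply: countable_bigcupT_measurable; first exact: countableP.
  by move=> c; case: ifP.
apply/seteqP; split=> x; last first.
  by move=> [c _]; case: ifPn => // /asboolP cU /preE /cU.
rewrite /= => Ux; have : nbhs (\row_i F x i) U by exact: open_nbhs_nbhs.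
move=> /nbhs_ballP[e /= e0 eU].
(* With radius at most [e / 2], a ball that contains the point lies inside the
   ball of radius [e] around it. *)
have e20 : 0 < e / 2 by rewrite divr_gt0.
have [n _ /(_ n (leqnn n)) /= ne] := near_infty_natSinv_lt (PosNum e20).
have qP i : exists q, ratr q \in `]F x i - n.+1%:R^-1, F x i + n.+1%:R^-1[%R.
  by apply: rat_in_itvoo; rewrite ltrBlDr -addrA ltrDl addr_gt0.
have [q qE] := choice qP.
pose c := (\row_i q i, n) : 'rV[rat]_k * nat.
have cx : bal c (\row_i F x i).
  split=> [|i j]; first by rewrite invr_gt0.
  rewrite /c !mxE /ball /= /ball_ /= ltr_distlC.
  have := qE j; rewrite in_itv /= => /andP[qgt qlt].
  by rewrite ltrBlDr qlt -ltrBlDr.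
exists c => //; rewrite ifT; first exact/preE.
apply/asboolP => y cy; apply: eU.
rewrite (splitr e); apply: (ball_triangle (y := ctr c.1)).
  apply: le_ball (ltW ne) _ _; exact/ball_sym.
exact: le_ball (ltW ne) _ cy.
Qed.

Lemma measurable_coord (R : realType) (k : nat) (i : 'I_k) :
  measurable_fun [set: borel_rV R k] ((fun v : 'rV[R]_k => v 0 i) : borel_rV R k -> R).
Proof.
apply: (@measurability _ _ (borel_rV R k) R _ _ (@RGenOpens.G R)).
  exact: RGenOpens.measurableE.
move=> _ [_ [a [b ->]] <-]; rewrite setTI; apply: sub_sigma_algebra.
apply: open_comp; last exact: interval_open.
by move=> v _; exact: coord_continuous.
Qed.

(** * Spanning by differences of the natural parameters *)

(** As long as the rank is below [k], some nonzero [a] is orthogonal to the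
    rows already chosen; a [v theta] that is not orthogonal to [a] increases
    the rank. *)
Lemma row_full_family (R : realType) (Theta : Type) (k : nat)
    (v : Theta -> 'rV[R]_k) :
  (forall a : 'cV[R]_k, (forall theta, v theta *m a = 0) -> a = 0) ->
  exists n (t : 'I_n -> Theta), row_full (\matrix_(i < n) v (t i)).
Proof.
move=> hv.
suff H m : (m <= k)%N ->
    exists n (t : 'I_n -> Theta), (m <= \rank (\matrix_(i < n) v (t i)))%N.
  have [n [t rt]] := H k (leqnn k); exists n, t.
  by rewrite /row_full eqn_leq rank_leq_col rt.
elim: m => [_|m IH mk].
  by exists 0%N,
    (fun i : 'I_0 => match i with Ordinal _ h => False_rect _ (notF h) end).
have [n [t mt]] := IH (ltnW mk).
set M := \matrix_(i < n) v (t i) in mt *.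
have [|rM] := ltnP m (\rank M); first by exists n, t.
have : cokermx M != 0.
  by rewrite -mxrank_eq0 mxrank_coker subn_eq0 -ltnNge (leq_ltn_trans rM).
case/matrix0Pn => i [j aij].
pose a := col j (cokermx M).
have Ma : M *m a = 0 by rewrite /a colE mulmxA mulmx_coker mul0mx.
have [theta va] : exists theta, v theta *m a != 0.
  apply: contrapT => /forallNP va.
  have /hv /matrixP /(_ i 0) : forall theta, v theta *m a = 0.
    by move=> theta; apply/eqP; have /negP := va theta; rewrite negbK.
  by rewrite mxE [RHS]mxE => /eqP; rewrite (negbTE aij).
pose t' (l : 'I_(1 + n)) := if fintype.split l is inr l' then t l' else theta.
exists (1 + n)%N, t'.
have -> : \matrix_(l < 1 + n) v (t' l) = col_mx (v theta) M.
  apply/matrixP => l c; rewrite !mxE /t'; case: splitP => l' _; rewrite ?mxE//.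
  by rewrite (ord1 l').
apply: leq_ltn_trans mt _; apply: rank_ltmx; rewrite ltmxE.
have := submx_refl (col_mx (v theta) M); rewrite col_mx_sub => /andP[_ ->] /=.
rewrite col_mx_sub negb_and; apply/orP; left; apply: contra va => /submxP[D ->].
by rewrite -mulmxA Ma mulmx0.
Qed.

(** If [a] is orthogonal to all the differences [eta theta - eta theta0], then
    [sum_i a_i eta_i] is constant, so [a = 0]; hence finitely many differences
    span, and [D] is a left inverse of the matrix that they form. *)
Lemma coordinates_from_differences (R : realType) (Theta : Type) (k : nat)
    (eta : 'I_k -> Theta -> R) (theta0 : Theta) :
  (forall (a0 : R) (a : 'I_k -> R),
    (forall theta, \sum_(i < k) a i * eta i theta = a0) ->
    a0 = 0 /\ forall i, a i = 0) ->
  exists n (t : 'I_n -> Theta) (D : 'M[R]_(k, n)),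
    forall (w : 'I_k -> R) (i : 'I_k), w i =
      \sum_(j < n) D i j * (\sum_(l < k) eta l (t j) * w l -
                            \sum_(l < k) eta l theta0 * w l).
Proof.
move=> hindep.
pose v theta : 'rV[R]_k := \row_i (eta i theta - eta i theta0).
have vE theta (c : 'cV[R]_k) : (v theta *m c) 0 0 =
    \sum_(l < k) eta l theta * c l 0 - \sum_(l < k) eta l theta0 * c l 0.
  by rewrite mxE -sumrB; apply: eq_bigr => l _; rewrite mxE mulrBl.
have [a va|n [t /row_fullP[D DM]]] := row_full_family (v := v).
  have [theta|_ a0] := hindep (\sum_(i < k) a i 0 * eta i theta0) (a^~ 0).
    apply/eqP; rewrite -subr_eq0 -[X in _ == X](_ : (v theta *m a) 0 0 = 0).
      by rewrite vE; apply/eqP; congr (_ - _); apply: eq_bigr => i _; rewrite mulrC.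
    by rewrite va mxE.
  by apply/matrixP => i j; rewrite (ord1 j) mxE a0.
exists n, t, D => w i; pose c : 'cV[R]_k := \col_l w l.
have -> : w i = (D *m (\matrix_j v (t j) *m c)) i 0.
  by rewrite mulmxA DM mul1mx mxE.
rewrite mxE; apply: eq_bigr => j _; congr (_ * _).
have -> : ((\matrix_j' v (t j')) *m c) j 0 = (v (t j) *m c) 0 0.
  by rewrite !mxE; apply: eq_bigr => l _; rewrite mxE.
by rewrite vE; congr (_ - _); apply: eq_bigr => l _; rewrite mxE.
Qed.

(** * Exponential families *)

(** Up to a null set [h] may be replaced by its positive part, since
    [exp(u) h] is a density; then [P0] has the nonnegative density
    [exp(u0) h] with respect to [mu], and [exp(u) h = exp(u - u0) exp(u0) h]. *)
Lemma expfam_density (R : realType) (d : measure_display)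
    (X : measurableType d) (P P0 : probability X R)
    (mu : {sigma_finite_measure set X -> \bar R}) (f f0 u u0 h : X -> R) :
  is_density mu P f -> is_density mu P0 f0 ->
  measurable_fun [set: X] u -> measurable_fun [set: X] u0 ->
  measurable_fun [set: X] h ->
  {ae mu, forall x, f x = expR (u x) * h x} ->
  {ae mu, forall x, f0 x = expR (u0 x) * h x} ->
  forall A, measurable A ->
    P A = (\int[P0]_(x in A) (expR (u x - u0 x))%:E)%E.
Proof.
move=> fP f0P mu_u mu0 mh fu fu0 A mA.
have mexp (w : X -> R) : measurable_fun [set: X] w ->
    measurable_fun [set: X] (expR \o w).
  by move=> mw; exact: measurableT_comp.
pose hp x := Num.max (h x) 0.
have mhp : measurable_fun [set: X] hp by exact: measurable_maxr.
have hp0 x : 0 <= hp x by rewrite le_max lexx orbT.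
have hph : {ae mu, forall x, hp x = h x}.
  have := density_ge0_ae fP; apply: filterS2 fu => x ->.
  by rewrite pmulr_rge0 ?expR_gt0// /hp => /max_idPl.
have PE (Q : probability X R) (g w : X -> R) : is_density mu Q g ->
    measurable_fun [set: X] w -> {ae mu, forall x, g x = expR (w x) * h x} ->
    forall C, measurable C ->
      Q C = (\int[mu]_(x in C) (expR (w x) * hp x)%:E)%E.
  move=> [gint gE] mw gw C mC; rewrite gE//; apply: ae_eq_integral => //.
  - exact/measurable_funTS/measurable_int/gint.
  - by apply/measurable_EFinP/measurable_funTS/measurable_funM => //; exact: mexp.
  - by apply: filterS2 gw hph => x -> ->.
rewrite (@ge0_integral_density _ _ _ P0 mu (fun x => expR (u0 x) * hp x))//; last 4 first.
- by apply: measurable_funM => //; exact: mexp.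
- by move=> x; rewrite mulr_ge0 ?expR_ge0.
- exact: PE f0P mu0 fu0.
- apply/measurable_EFinP/measurable_funTS/mexp; exact: measurable_funB.
rewrite (PE _ _ _ fP mu_u fu)//; apply: eq_integral => x _.
by rewrite -EFinM mulrA -expRD subrK.
Qed.

Theorem mainTheorem5 (R : realType) (d : measure_display)
  (X : measurableType d) (Theta : Type) (hTheta : inhabited Theta)
  (P : Theta -> probability X R)
  (mu : {sigma_finite_measure set X -> \bar R})
  (hdom : forall theta : Theta, P theta `<< mu)
  (hX : analytic_Borel R X)
  (f : Theta -> X -> R)
  (hf : forall theta : Theta, is_density mu (P theta) (f theta))
  (k : nat) (eta : 'I_k -> Theta -> R) (B : Theta -> R)
  (T : 'I_k -> X -> R) (h : X -> R)
  (hT : forall i : 'I_k, measurable_fun [set: X] (T i))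
  (hh : measurable_fun [set: X] h)
  (hexp : forall theta : Theta,
    {ae mu, forall x : X,
      f theta x = expR ((\sum_(i < k) eta i theta * T i x) - B theta) * h x})
  (hindep : forall (a0 : R) (a : 'I_k -> R),
    (forall theta : Theta, \sum_(i < k) a i * eta i theta = a0) ->
    a0 = 0 /\ forall i : 'I_k, a i = 0) :
  minimal_sufficient P
    ((fun x : X => \row_(i < k) T i x) : X -> borel_rV R k).
Proof.
case: hTheta => theta0.
pose TT (x : X) : borel_rV R k := \row_(i < k) T i x.
pose u theta (x : X) := (\sum_(i < k) eta i theta * T i x) - B theta.
have mu_u theta : measurable_fun [set: X] (u theta).
  apply: measurable_funB => //; apply: measurable_sum => i.
  exact: measurable_funM.
pose lin theta (t : borel_rV R k) : R :=
  (\sum_(i < k) eta i theta * (t : 'rV[R]_k) 0 i) - B theta.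
have linTT theta x : lin theta (TT x) = u theta x.
  by rewrite /lin /u; under eq_bigr do rewrite mxE.
have mlin theta : measurable_fun [set: borel_rV R k] (lin theta).
  apply: measurable_funB => //; apply: measurable_sum => i.
  by apply: measurable_funM => //; exact: measurable_coord.
pose r theta (t : borel_rV R k) := expR (lin theta t - lin theta0 t).
have mr theta : measurable_fun [set: borel_rV R k] (r theta).
  by apply: measurableT_comp => //; exact: measurable_funB.
have mTT : measurable_fun [set: X] TT by exact: measurable_row.
have mrTT theta : measurable_fun [set: X] (r theta \o TT).
  exact: measurableT_comp.
have Pr theta A : measurable A ->
    P theta A = (\int[P theta0]_(x in A) (r theta (TT x))%:E)%E.
  move=> mA; under eq_integral do rewrite /r !linTT.
  exact: (expfam_density (hf theta) (hf theta0) (mu_u theta) (mu_u theta0) hh).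
split.
  apply: (@sufficient_of_factored_density _ _ _ _ _ _ P (P theta0) TT r) => //.
  by move=> theta s; exact: expR_ge0.
move=> d'' SS S sufS.
have dom theta : P theta `<< P theta0.
  apply/null_content_dominatesP => A mA A0; rewrite Pr// null_set_integral//.
  exact/measurable_EFinP/measurable_funTS/mrTT.
have [rho rhoP] :=
  choice (fun theta => factored_density_of_sufficient sufS (dom theta)).
have rhoE theta : {ae P theta0, forall x, rho theta (S x) = r theta (TT x)}.
  have [mrho rho0 Prho] := rhoP theta.
  apply: (@density_unique _ _ _ (P theta) _ (rho theta \o S) (r theta \o TT)) => //.
  - exact: measurableT_comp mrho sufS.1.
  - by move=> x; exact: rho0.
  - exact: Pr.
have [n [t [D TE]]] := coordinates_from_differences theta0 hindep.
(* By [rhoE], [ln (rho (t j) (S x)) + (B (t j) - B theta0)] is the [j]-th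
   difference of linear forms in [TE], evaluated at [T^~ x]. *)
pose g (s : SS) : borel_rV R k := \row_(i < k)
  \sum_(j < n) D i j * (ln (rho (t j) s) + (B (t j) - B theta0)).
exists g.
  apply: measurable_row => i; apply: measurable_sum => j.
  apply: measurable_funM => //; apply: measurable_funD => //.
  by apply: measurableT_comp; [exact: measurable_ln|have [] := rhoP (t j)].
move=> theta.
suff [N [mN N0 subN]] : {ae P theta0, forall x, TT x = g (S x)}.
  by exists N; split=> //; move/null_content_dominatesP: (dom theta); apply.
have /filter_forall :
    forall j, {ae P theta0, forall x, rho (t j) (S x) = r (t j) (TT x)}.
  by move=> j; exact: rhoE.
apply: filterS => x rx; apply/rowP => i.
rewrite !mxE [LHS](TE (T^~ x)); apply: eq_bigr => j _; congr (_ * _).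
rewrite rx expRK !linTT /u; ring.
Qed.
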